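(* For every positive integer $k$ there is a deterministic algorithm in the ordinal query model that, on every finite metric space $(X,d)$ and every consistent profile, makes at most $2k$ distance queries and outputs a set $C\subseteq X$ with $|C|\le k$ such that $\max_{x\in X}d(x,C)\le 4\cdot\mathrm{OPT}^{\mathrm{center}}_k(X,d)$.
   Context: Ordinal query model: $(X,d)$ is a finite metric space with $|X|=n$. Every point $x\in X$ reports a ranking $\pi_x$ of all points of $X$ such that $y$ is ranked above $y'$ only if $d(x,y)\le d(x,y')$ (ties broken arbitrarily); the collection $P=\{\pi_x\}_{x\in X}$ is a profile consistent with $d$. An algorithm receives $X$, $k$ and $P$ for free. Its only other access to $d$ is by querying the exact value $d(x,y)$ for pairs of its choice; each such value costs one query. For $C\subseteq X$ write $d(x,C)=\min_{c\in C}d(x,c)$. The $k$-center cost of $C$ is $\max_{x\in X}d(x,C)$, and $\mathrm{OPT}^{\mathrm{center}}_k(X,d)=\min_{C\subseteq X,|C|=k}\max_{x\in X}d(x,C)$. *)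

(* Defs.v *)
From mathcomp Require Import all_boot all_order all_algebra.
From mathcomp Require Import reals.
Set Implicit Arguments. Unset Strict Implicit. Unset Printing Implicit Defensive.
Import Order.TTheory GRing.Theory Num.Theory.
Local Open Scope ring_scope.

Definition is_metric (R : realType) (T : finType) (d : T -> T -> R) : Prop :=
  [/\ forall x y, 0 <= d x y,
      forall x y, d x y = 0 <-> x = y,
      forall x y, d x y = d y x
    & forall x y z, d x z <= d x y + d y z].

Definition consistent_profile (R : realType) (T : finType) (d : T -> T -> R)
    (pi : T -> seq T) : Prop :=
  forall x, perm_eq (pi x) (enum T) /\
            pairwise (fun y y' => d x y <= d x y') (pi x).

(* Deterministic adaptive query algorithms as decision trees: either output a
   set of centers, or query d(x,y) and continue depending on the answer. *)
Inductive qtree (T : finType) (R : Type) : Type :=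
| QOut of {set T}
| QAsk of T & T & (R -> qtree T R).

Fixpoint run (T : finType) (R : Type) (d : T -> T -> R) (t : qtree T R)
  : {set T} * nat :=
  match t with
  | QOut C => (C, 0%N)
  | QAsk x y f => let r := run d (f (d x y)) in (r.1, r.2.+1)
  end.

(* The k-center cost of C is at most r: every point is within r of some
   center in C (i.e. max_x d(x,C) <= r, with d(x,set0) = +oo). *)
Definition center_cost_le (R : realType) (T : finType) (d : T -> T -> R)
    (C : {set T}) (r : R) : Prop :=
  forall x, exists2 c, c \in C & d x c <= r.

(* Main.v *)
Require Import Defs.
From mathcomp Require Import all_boot all_order all_algebra.
From mathcomp Require Import reals constructive_ereal.
From mathcomp Require Import zify lra.
Set Implicit Arguments.
Unset Strict Implicit.
Unset Printing Implicit Defensive.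
Import Order.TTheory GRing.Theory Num.Theory.
Local Open Scope ring_scope.

(** Farthest-point traversal, run lazily for [2k] queries so as to collect
    [2k+1] candidate centers.  A candidate carries an upper bound on the radius
    of the cluster of points it owns.  Each query takes the candidate [b] with
    the largest bound and asks for [v = d(b, y)], where [y] is the point of the
    cluster of [b] that [b] ranks last.  Then [y] becomes a candidate with
    birth value [v], the bounds of [b] and [y] become [v], and [y] captures the
    points that prefer it to their owner and that lie in its ball of radius
    [v]; the ranking of [y] reveals this ball, since [d(y, b) = v].  Hence two
    candidates are at distance at least the smaller of their birth values.

    Let [w] be the [(k+1)]-st largest birth value; call a candidate early if it
    is born above [w] and late otherwise, and output the early ones.  By
    pigeonhole [w <= 2 OPT].  While some bound exceeds [w], the queried [b] is
    early, so that a late [y] is within [w] of an early candidate.  Moreover an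
    answer above [w] adds one early candidate and one bound above [w], and any
    other answer removes one bound above [w]; so twice the number of early
    candidates exceeds the number of bounds above [w] by the number of
    candidates.  As at most [k] of the [2k+1] candidates are early, all bounds
    must at some moment have been at most [w]: then every point is within [w]
    of a candidate, which is itself within [w] of an early one. *)

Section DescendingRank.
Variables (disp : Order.disp_t) (V : orderType disp) (I : finType) (f : I -> V).
Local Open Scope order_scope.

Definition descending_rank (i : I) : nat := #|[set j | f i <= f j]|.

Lemma leq_descending_rank i j :
  f i <= f j -> (descending_rank j <= descending_rank i)%N.
Proof.
move=> le_ij; apply/subset_leq_card/subsetP => l; rewrite !inE.
exact: le_trans.
Qed.

Lemma card_descending_rank_le k :
  (#|[set i | (descending_rank i <= k)%N]| <= k)%N.
Proof.
set A := [set i | _].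
have [->|[i0 Ai0]] := set_0Vmem A; first by rewrite cards0.
have [i Ai min_i] := arg_minP f (Ai0 : mem A i0).
have rank_i : (descending_rank i <= k)%N by move: Ai; rewrite /= inE.
apply: leq_trans rank_i; apply/subset_leq_card/subsetP => j Aj.
by rewrite inE min_i.
Qed.

Lemma descending_rank_threshold k : (k < #|I|)%N ->
  exists2 i, (k < descending_rank i)%N &
    forall j, (descending_rank j <= k)%N = (f i < f j).
Proof.
move=> lt_k; have /card_gt0P[i0 _] : (0 < #|I|)%N by apply: leq_trans lt_k.
have [imin _ min_imin] := arg_minP f (erefl : xpredT i0).
have rank_imin : (k < descending_rank imin)%N.
  rewrite /descending_rank (_ : [set j | _] = setT) ?cardsT //.
  by apply/setP => j; rewrite !inE min_imin.
have [i /= rank_i max_i] :=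
  arg_maxP f (rank_imin : [pred i | k < descending_rank i]%N imin).
exists i => // j; apply/idP/idP => [rank_j|lt_ij].
  rewrite ltNge; apply/negP => /leq_descending_rank /leq_trans /(_ rank_j).
  by rewrite leqNgt rank_i.
by rewrite leqNgt; apply/negP => /max_i; rewrite leNgt lt_ij.
Qed.

End DescendingRank.

Lemma sum_nat_update (I : finType) (F : I -> nat) (b : I) (x : nat) :
  (\sum_i (if i == b then x else F i) + F b = \sum_i F i + x)%N.
Proof.
rewrite (bigD1 b) //= eqxx [in RHS](bigD1 b) //=.
rewrite (eq_bigr F) => [|i /negbTE-> //]; lia.
Qed.

Lemma pairwise_last (T : eqType) (r : rel T) (x0 : T) (s : seq T) (x : T) :
  reflexive r -> pairwise r s -> x \in s -> r x (last x0 s).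
Proof.
move=> r_refl; case/lastP: s => // s y.
rewrite pairwise_rcons last_rcons mem_rcons inE => /andP[/allP le_y _].
by case/orP=> [/eqP->|/le_y].
Qed.

Section Metric.
Variables (R : realType) (T : finType) (d : T -> T -> R).
Hypothesis metric_d : is_metric d.

Lemma metric_ge0 x y : 0 <= d x y. Proof. by case: metric_d. Qed.

Lemma metricxx x : d x x = 0.
Proof. by case: metric_d => _ /(_ x x)[_ ->]. Qed.

Lemma metricC x y : d x y = d y x. Proof. by case: metric_d. Qed.

Lemma metric_triangle y x z : d x z <= d x y + d y z.
Proof. by case: metric_d. Qed.

Lemma center_cost_pigeonhole (I : finType) (s : I -> T) (A : {set I})
    (C : {set T}) (r : R) :
  center_cost_le d C r -> (#|C| < #|A|)%N ->
  exists i j, [/\ i \in A, j \in A, i != j & d (s i) (s j) <= 2 * r].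
Proof.
move=> /fin_all_exists2[c Cc le_c] lt_CA.
have : ~~ dinjectiveb (c \o s) A.
  apply/negP => /dinjectiveP/card_in_imset cardA.
  move: lt_CA; rewrite -cardA ltnNge => /negP; apply.
  by apply/subset_leq_card/subsetP => _ /imsetP[i _ ->]; apply: Cc.
case/dinjectivePn=> i Ai [j /andP[/= ne_ji Aj] eq_c].
exists i, j; split=> //; first by rewrite eq_sym.
apply: le_trans (metric_triangle (c (s i)) _ _) _.
have le_j : d (c (s i)) (s j) <= r by rewrite [c _]eq_c metricC.
by have := le_c (s i); lra.
Qed.

End Metric.

Lemma center_cost_le_subset (R : realType) (T : finType) (d : T -> T -> R)
    (C C' : {set T}) (r r' : R) :
  C \subset C' -> r <= r' -> center_cost_le d C r -> center_cost_le d C' r'.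
Proof.
move=> /subsetP sub le_r cost x; have [c /sub Cc le_d] := cost x.
by exists c => //; apply: le_trans le_r.
Qed.

Section Consistency.
Variables (R : realType) (T : finType) (d : T -> T -> R) (pi : T -> seq T).
Hypothesis consistent_pi : consistent_profile d pi.

Lemma consistent_mem x y : y \in pi x.
Proof. by have [/perm_mem -> _] := consistent_pi x; rewrite mem_enum. Qed.

Lemma consistent_index_le x y z :
  (index y (pi x) <= index z (pi x))%N -> d x y <= d x z.
Proof.
have [_ /pairwise_sorted sorted_pi] := consistent_pi x.
have d_trans : transitive (fun y y' => d x y <= d x y').
  by move=> ? ? ?; apply: le_trans.
have d_refl : reflexive (fun y y' => d x y <= d x y') by move=> ?; apply: lexx.
by apply: (sorted_leq_index d_trans d_refl sorted_pi); apply: consistent_mem.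
Qed.

End Consistency.

Section Algorithm.
Variables (R : realType) (T : finType) (pi : T -> seq T).

(* The candidates are the [center]s of index [0 .. nqueries].  They are indexed
   because a point may occur twice among them (one copy then has birth value
   [0]). *)
Record clustering := Clustering {
  nqueries : nat;
  center : nat -> T;
  birth : nat -> \bar R;
  radius : nat -> \bar R;
  owner : T -> nat }.

Implicit Type st : clustering.

Definition one_cluster (x0 : T) : clustering :=
  Clustering 0 (fun=> x0) (fun=> +oo%E) (fun=> +oo%E) (fun=> 0%N).

Definition widest st : 'I_(nqueries st).+1 :=
  [arg max_(i > ord0) radius st i]%O.

Definition widest_center st : T := center st (widest st).

(* The default [widest_center st] is reached when the widest candidate has lost
   its whole cluster. *)
Definition farthest st : T :=
  last (widest_center st)
    [seq z <- pi (widest_center st) | owner st z == widest st].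

Definition captured st : pred T := fun z =>
  let y := farthest st in
  (index z (pi y) <= index (widest_center st) (pi y))%N &&
  (index y (pi z) <= index (center st (owner st z)) (pi z))%N.

Definition split_widest st (v : R) : clustering :=
  let n := (nqueries st).+1 in
  Clustering n
    (fun i => if i == n then farthest st else center st i)
    (fun i => if i == n then v%:E else birth st i)
    (fun i => if (i == n) || (i == widest st) then v%:E else radius st i)
    (fun z => if captured st z then n else owner st z).

Definition birth_rank st : 'I_(nqueries st).+1 -> nat :=
  descending_rank (fun i : 'I_(nqueries st).+1 => birth st i).

Definition top_centers (k : nat) st : {set T} :=
  [set center st (val i) |
    i in [set i : 'I_(nqueries st).+1 | (birth_rank i <= k)%N]].

Fixpoint explore (k m : nat) st : qtree T R :=
  if m is m'.+1 then
    QAsk (widest_center st) (farthest st)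
      (fun v => explore k m' (split_widest st v))
  else QOut R (top_centers k st).

Definition kcenter_tree (k : nat) : qtree T R :=
  if [pick x0 : T] is Some x0 then explore k (2 * k) (one_cluster x0)
  else QOut R set0.

Lemma radius_le_widest st i :
  (i <= nqueries st)%N -> (radius st i <= radius st (widest st))%E.
Proof.
rewrite -ltnS /widest => lt_i.
case: Order.TotalTheory.arg_maxP => //= b _ max_b.
exact: (max_b (Ordinal lt_i)).
Qed.

Lemma farthest_owner st :
  owner st (farthest st) = widest st \/ farthest st = widest_center st.
Proof.
rewrite /farthest; set l := [seq _ <- _ | _].
have := mem_last (widest_center st) l.
rewrite inE => /orP[/eqP|]; first by right.
by rewrite mem_filter => /andP[/eqP ? _]; left.
Qed.

Lemma card_top_centers k st : (#|top_centers k st| <= k)%N.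
Proof.
exact: leq_trans (leq_imset_card _ _) (card_descending_rank_le _ _).
Qed.

End Algorithm.

Section Traversal.
Variables (R : realType) (T : finType) (d : T -> T -> R) (pi : T -> seq T).
Hypotheses (metric_d : is_metric d) (consistent_pi : consistent_profile d pi).
Local Notation metricC := (metricC metric_d).

Implicit Types (st : clustering R T) (w : \bar R).

Definition widest_dist st : R := d (widest_center st) (farthest pi st).

Definition next st : clustering R T := split_widest pi st (widest_dist st).

Definition owner_dist st (z : T) : R := d z (center st (owner st z)).

Lemma run_explore k m st :
  run d (explore pi k m st) = (top_centers k (iter m next st), m).
Proof. by elim: m st => [|m IHm] st //=; rewrite IHm -iterSr. Qed.

Lemma nqueries_iter m st : nqueries (iter m next st) = (m + nqueries st)%N.
Proof. by elim: m => //= m ->. Qed.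

Lemma center_next st i :
  (i <= nqueries st)%N -> center (next st) i = center st i.
Proof. by move=> le_i /=; rewrite ltn_eqF. Qed.

Lemma birth_next st i :
  (i <= nqueries st)%N -> birth (next st) i = birth st i.
Proof. by move=> le_i /=; rewrite ltn_eqF. Qed.

Lemma radius_next st i : (i <= nqueries st)%N ->
  radius (next st) i =
    if i == widest st then (widest_dist st)%:E else radius st i.
Proof. by move=> le_i /=; rewrite ltn_eqF. Qed.

Lemma center_next_last st :
  center (next st) (nqueries st).+1 = farthest pi st.
Proof. by rewrite /= eqxx. Qed.

Lemma birth_next_last st :
  birth (next st) (nqueries st).+1 = (widest_dist st)%:E.
Proof. by rewrite /= eqxx. Qed.

Lemma radius_next_last st :
  radius (next st) (nqueries st).+1 = (widest_dist st)%:E.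
Proof. by rewrite /= eqxx. Qed.

Lemma dist_widest_le_farthest st z :
  owner st z = widest st -> d (widest_center st) z <= widest_dist st.
Proof.
move=> owner_z; set x := widest_center st.
have [_ /(pairwise_filter (fun t => owner st t == widest st)) pairwise_l] :=
  consistent_pi x.
apply: (pairwise_last _ (fun y => lexx (d x y)) pairwise_l).
by rewrite mem_filter owner_z eqxx (consistent_mem consistent_pi).
Qed.

Lemma captured_dist_le st z : captured pi st z ->
  d z (farthest pi st) <= widest_dist st /\
  d z (farthest pi st) <= owner_dist st z.
Proof.
case/andP=> near_y prefers_y.
rewrite /widest_dist [d z _]metricC [d (widest_center _) _]metricC.
by split; [|rewrite metricC]; apply: (consistent_index_le consistent_pi).
Qed.

Lemma uncaptured_dist_ge st z : ~~ captured pi st z ->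
  widest_dist st <= d z (farthest pi st) \/
  owner_dist st z <= d z (farthest pi st).
Proof.
rewrite negb_and -!ltnNge.
case/orP=> /ltnW/(consistent_index_le consistent_pi); last by right.
by left; rewrite /widest_dist metricC [d z _]metricC.
Qed.

Record valid_clustering st : Prop := ValidClustering {
  owner_le : forall z, (owner st z <= nqueries st)%N;
  owner_dist_le_radius : forall z,
    ((owner_dist st z)%:E <= radius st (owner st z))%E;
  owner_nearest : forall z i, (i <= nqueries st)%N ->
    (Order.min (birth st i) (owner_dist st z)%:E <= (d z (center st i))%:E)%E;
  center_sep : forall i j, (i <= nqueries st)%N -> (j <= nqueries st)%N ->
    i != j ->
    (Order.min (birth st i) (birth st j) <=
      (d (center st i) (center st j))%:E)%E;
  radius_ge0 : forall i, (0 <= radius st i)%E;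
  radius_le_birth : forall i, (radius st i <= birth st i)%E }.

Lemma valid_one_cluster x0 : valid_clustering (one_cluster R x0).
Proof.
split=> //= [z|i j|i]; rewrite ?leey //.
by rewrite !leqn0 => /eqP-> /eqP->.
Qed.

Section ValidNext.
Variable st : clustering R T.
Hypothesis valid_st : valid_clustering st.

Lemma birth_ge0 i : (0 <= birth st i)%E.
Proof. exact: le_trans (radius_ge0 _ i) (radius_le_birth _ i). Qed.

Lemma widest_dist_le_radius : ((widest_dist st)%:E <= radius st (widest st))%E.
Proof.
rewrite /widest_dist; case: (farthest_owner pi st) => [owner_y|->].
  rewrite metricC -owner_y /widest_center -owner_y.
  exact: owner_dist_le_radius.
by rewrite metricxx // radius_ge0.
Qed.

Lemma owner_dist_next z :
  owner_dist (next st) z =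
    if captured pi st z then d z (farthest pi st) else owner_dist st z.
Proof.
rewrite /owner_dist [owner _ z]/=; case: ifP => _.
  by rewrite center_next_last.
by rewrite center_next // owner_le.
Qed.

Lemma owner_dist_next_le z : owner_dist (next st) z <= owner_dist st z.
Proof. by rewrite owner_dist_next; case: ifP => // /captured_dist_le[]. Qed.

Lemma owner_dist_le_radius_next z :
  ((owner_dist (next st) z)%:E <= radius (next st) (owner (next st) z))%E.
Proof.
rewrite owner_dist_next [owner _ z]/=.
case: ifP => [/captured_dist_le[le_v _]|_].
  by rewrite radius_next_last lee_fin.
rewrite radius_next ?owner_le //; case: eqP => [owner_z|_].
  by rewrite lee_fin /owner_dist owner_z metricC dist_widest_le_farthest.
exact: owner_dist_le_radius.
Qed.

Lemma owner_nearest_next z i : (i <= nqueries (next st))%N ->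
  (Order.min (birth (next st) i) (owner_dist (next st) z)%:E <=
    (d z (center (next st) i))%:E)%E.
Proof.
rewrite leq_eqVlt => /orP[/eqP->|le_i].
  rewrite birth_next_last center_next_last owner_dist_next ge_min !lee_fin.
  by case: ifPn => [_|/uncaptured_dist_ge/orP //]; rewrite lexx orbT.
rewrite birth_next // center_next //.
apply: le_trans (owner_nearest valid_st z le_i).
by rewrite le_min !ge_min lexx lee_fin owner_dist_next_le orbT.
Qed.

Lemma farthest_sep i : (i <= nqueries st)%N ->
  (Order.min (birth st i) (widest_dist st)%:E <=
    (d (center st i) (farthest pi st))%:E)%E.
Proof.
move=> le_i; case: (farthest_owner pi st) => [owner_y|eq_y].
  have := owner_nearest valid_st (farthest pi st) le_i.
  by rewrite /owner_dist owner_y /widest_dist ![d (farthest _ _) _]metricC.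
by rewrite ge_min !lee_fin /widest_dist eq_y metricxx // metric_ge0 // orbT.
Qed.

Lemma center_sep_next i j :
  (i <= nqueries (next st))%N -> (j <= nqueries (next st))%N -> i != j ->
  (Order.min (birth (next st) i) (birth (next st) j) <=
    (d (center (next st) i) (center (next st) j))%:E)%E.
Proof.
rewrite leq_eqVlt => /orP[/eqP->|le_i];
  rewrite leq_eqVlt => /orP[/eqP->|le_j] ne_ij.
- by rewrite eqxx in ne_ij.
- rewrite birth_next_last center_next_last birth_next // center_next //.
  by rewrite minC metricC farthest_sep.
- rewrite birth_next_last center_next_last birth_next // center_next //.
  exact: farthest_sep.
- by rewrite !birth_next // !center_next // center_sep.
Qed.

Lemma valid_next : valid_clustering (next st).
Proof.
split=> [z||||i|i].
- by rewrite /=; case: ifP => // _; apply/leqW/owner_le.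
- exact: owner_dist_le_radius_next.
- exact: owner_nearest_next.
- exact: center_sep_next.
- rewrite /=; case: ifP => _; last exact: radius_ge0.
  by rewrite lee_fin metric_ge0.
- rewrite /=; case: eqP => //= _.
  case: eqP => [->|_]; last exact: radius_le_birth.
  exact: le_trans widest_dist_le_radius (radius_le_birth valid_st _).
Qed.

End ValidNext.

Definition early w st : {set T} :=
  [set center st (val i) |
    i in [set i : 'I_(nqueries st).+1 | (w < birth st i)%E]].

Definition early_count w st : nat :=
  \sum_(i < (nqueries st).+1) (w < birth st i)%E.

Definition wide_count w st : nat :=
  \sum_(i < (nqueries st).+1) (w < radius st i)%E.

Definition balanced w st : Prop :=
  ((nqueries st).+1 + wide_count w st = 2 * early_count w st)%N.

Definition covered (w : R) st : Prop :=
  center_cost_le d (early w%:E st) (2 * w).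

Definition late_linked (w : R) st : Prop :=
  forall i, (i <= nqueries st)%N -> (birth st i <= w%:E)%E ->
    exists2 c, c \in early w%:E st & d (center st i) c <= w.

Lemma mem_early w st i :
  (i <= nqueries st)%N -> (w < birth st i)%E -> center st i \in early w st.
Proof.
rewrite -ltnS => lt_i lt_w.
by apply/imsetP; exists (Ordinal lt_i) => //; rewrite inE.
Qed.

Lemma early_next_sub w st : early w st \subset early w (next st).
Proof.
apply/subsetP => _ /imsetP[i /[!inE] lt_w ->].
have le_i := leq_ord i.
by rewrite -center_next // mem_early ?birth_next // leqW.
Qed.

Lemma covered_next (w : R) st : covered w st -> covered w (next st).
Proof. by apply: center_cost_le_subset; rewrite ?early_next_sub. Qed.

Lemma narrow_covered (w : R) st :
  valid_clustering st -> late_linked w st ->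
  (radius st (widest st) <= w%:E)%E -> covered w st.
Proof.
move=> valid_st linked narrow z; have le_z := owner_le valid_st z.
set x := center st (owner st z).
have dist_x : d z x <= w.
  rewrite -lee_fin; apply: le_trans (owner_dist_le_radius valid_st z) _.
  exact: le_trans (radius_le_widest le_z) narrow.
have [lt_w|le_w] := ltP w%:E (birth st (owner st z)).
  exists x; first exact: mem_early.
  by have := metric_ge0 metric_d z x; lra.
have [c early_c dist_c] := linked _ le_z le_w.
exists c => //; apply: le_trans (metric_triangle metric_d x _ _) _.
by rewrite mulr_natl mulr2n lerD.
Qed.

Lemma late_linked_next (w : R) st :
  (w%:E < birth st (widest st))%E -> late_linked w st ->
  late_linked w (next st).
Proof.
move=> early_widest linked i; rewrite leq_eqVlt => /orP[/eqP->|le_i].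
  rewrite birth_next_last center_next_last lee_fin => le_w.
  exists (widest_center st); last by rewrite metricC.
  by apply/(subsetP (early_next_sub _ _))/mem_early; rewrite ?leq_ord.
rewrite birth_next // center_next // => /(linked _ le_i)[c early_c dist_c].
by exists c => //; apply/(subsetP (early_next_sub _ _)).
Qed.

Lemma early_count_next w st :
  early_count w (next st) = (early_count w st + (w < (widest_dist st)%:E)%E)%N.
Proof.
rewrite /early_count big_ord_recr /= eqxx.
by under eq_bigr => i _ do rewrite ltn_eqF //.
Qed.

Lemma wide_count_next w st : (w < radius st (widest st))%E ->
  (wide_count w (next st)).+1 =
    (wide_count w st + (w < (widest_dist st)%:E)%E.*2)%N.
Proof.
move=> lt_w; pose wide (x : \bar R) : nat := (w < x)%E.
pose v := (widest_dist st)%:E.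
have wide_next (i : 'I_(nqueries st).+1) : wide (radius (next st) i) =
    if i == widest st then wide v else wide (radius st i).
  by rewrite radius_next ?leq_ord // -val_eqE; case: eqP.
rewrite /wide_count big_ord_recr [radius _ ord_max]radius_next_last.
rewrite (eq_bigr _ (fun i _ => wide_next i)).
have := sum_nat_update (wide \o radius st \o val) (widest st) (wide v).
by rewrite /wide /= lt_w addn1 -addSn => ->; rewrite -addnA addnn.
Qed.

Lemma balanced_next w st :
  (w < radius st (widest st))%E -> balanced w st -> balanced w (next st).
Proof.
move=> /wide_count_next; rewrite /balanced early_count_next /=; lia.
Qed.

Lemma valid_iter x0 m : valid_clustering (iter m next (one_cluster R x0)).
Proof. by elim: m => [|m]; [apply: valid_one_cluster|apply: valid_next]. Qed.

Lemma covered_or_balanced_iter (w : R) x0 m :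
  let st := iter m next (one_cluster R x0) in
  covered w st \/ late_linked w st /\ balanced w%:E st.
Proof.
elim: m => [|m [cov|[linked bal]]].
- right; split=> [i _ /=|]; first by rewrite leye_eq.
  by rewrite /balanced /wide_count /early_count /= !big_ord1 ltry.
- by left; apply: covered_next.
set st := iter m next _ in linked bal *; have valid_st := valid_iter x0 m.
have [wide|narrow] := ltP w%:E (radius st (widest st)).
  right; split; last exact: balanced_next.
  apply: late_linked_next linked.
  exact: lt_le_trans wide (radius_le_birth valid_st _).
by left; apply/covered_next/narrow_covered.
Qed.

Lemma early_count_card w st :
  early_count w st = #|[set i : 'I_(nqueries st).+1 | (w < birth st i)%E]|.
Proof. by rewrite -sum1dep_card big_mkcond. Qed.

Lemma birth_le_twice_cost st (C : {set T}) (r : R)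
    (i : 'I_(nqueries st).+1) :
  valid_clustering st -> center_cost_le d C r -> (#|C| < birth_rank i)%N ->
  (birth st i <= (2 * r)%:E)%E.
Proof.
move=> valid_st cost_C.
case/(center_cost_pigeonhole metric_d (fun j : 'I__ => center st j) cost_C).
move=> j [l [/[!inE] le_j le_l ne_jl dist_jl]].
rewrite -lee_fin in dist_jl; apply: le_trans dist_jl.
apply: le_trans (center_sep valid_st _ _ ne_jl); rewrite ?leq_ord //.
by rewrite le_min le_j.
Qed.

Lemma top_centers_cost st k (C : {set T}) (r : R) :
  valid_clustering st -> (2 * k <= nqueries st)%N ->
  (forall w : R, covered w st \/ balanced w%:E st) ->
  (#|C| <= k)%N -> center_cost_le d C r ->
  center_cost_le d (top_centers k st) (4 * r).
Proof.
move=> valid_st many_queries cov card_C cost_C.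
have [|i rank_i topE] := descending_rank_threshold
    (fun i : 'I_(nqueries st).+1 => birth st i) (k := k).
  by rewrite card_ord; lia.
have le_2r := birth_le_twice_cost valid_st cost_C (leq_ltn_trans card_C rank_i).
have [w birth_i] : exists w : R, birth st i = w%:E.
  exists (fine (birth st i)); rewrite fineK // ge0_fin_numE ?birth_ge0 //.
  exact: le_lt_trans le_2r (ltry _).
rewrite birth_i lee_fin in le_2r.
have top_early : [set j | (birth_rank j <= k)%N] =
    [set j : 'I_(nqueries st).+1 | (w%:E < birth st j)%E].
  by apply/setP => j; rewrite !inE topE birth_i.
case: (cov w) => [|bal].
  by apply: center_cost_le_subset; [rewrite /top_centers top_early|lra].
have early_le_k : (early_count w%:E st <= k)%N.
  by rewrite early_count_card -top_early card_descending_rank_le.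
by move: bal; rewrite /balanced; lia.
Qed.

Lemma kcenter_tree_correct k :
  let res := run d (kcenter_tree R pi k) in
  [/\ (res.2 <= 2 * k)%N, (#|res.1| <= k)%N
    & forall (C : {set T}) (r : R), (#|C| <= k)%N ->
        center_cost_le d C r -> center_cost_le d res.1 (4 * r)].
Proof.
rewrite /kcenter_tree; case: pickP => [x0 _|noT]; last first.
  by split=> [||C r _ _ x] //=; [rewrite cards0|have := noT x].
rewrite run_explore /=; split=> // [|C r]; first exact: card_top_centers.
apply: top_centers_cost; first exact: valid_iter.
  by rewrite nqueries_iter addn0.
move=> w.
by case: (covered_or_balanced_iter w x0 (2 * k)) => [|[_]]; [left|right].
Qed.

End Traversal.

Theorem mainTheorem3 (R : realType) (k : nat) (hk : (0 < k)%N) :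
  exists A : forall n : nat, ('I_n -> seq 'I_n) -> qtree 'I_n R,
    forall (n : nat) (d : 'I_n -> 'I_n -> R) (pi : 'I_n -> seq 'I_n),
      is_metric d -> consistent_profile d pi ->
      let res := run d (A n pi) in
      [/\ (res.2 <= 2 * k)%N,
          (#|res.1| <= k)%N
        & forall (C' : {set 'I_n}) (r : R), #|C'| = k ->
            center_cost_le d C' r -> center_cost_le d res.1 (4 * r)].
Proof.
exists (fun n pi => kcenter_tree R pi k) => n d pi metric_d consistent_pi.
have [queries card_A cost_A] := kcenter_tree_correct metric_d consistent_pi k.
by split=> // C' r card_C'; apply: cost_A; rewrite card_C'.
Qed.
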